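(* Let $(X,f_{1,\infty})$ be a non-autonomous discrete dynamical system. Then the following are equivalent: (i) The system $(X,f_{1,\infty})$ is extended minimal. (ii) For every opene set $U\subset X$ and every point $x\in X$, there exists $\alpha\in\Sigma$ such that $f_\alpha(x)\in U$. (iii) For every opene set $U\subset X$ and every point $x\in X$, the set $N_e(x,U)$ is nonempty. (iv) For every $x\in X$, the extended orbit $J(x)$ is dense in $X$. (v) The set $T_e(f_{1,\infty})$ of all extended transitive points is equal to the entire space $X$. (vi) For every opene set $U\subset X$, $\bigcup_{\alpha\in\Sigma}f_\alpha^{-1}(U)=X$. (vii) For every opene set $U\subset X$, there exists a finite subset $\Sigma'\subset\Sigma$ such that $\bigcup_{\alpha\in\Sigma'}f_\alpha^{-1}(U)=X$. (viii) If $A\subset X$ is nonempty, closed and strong $+$ invariant, then $A=X$.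
   Context: $\mathbb{N}=\{1,2,3,\dots\}$. A non-autonomous discrete dynamical system (NDDS) is a pair $(X,f_{1,\infty})$ where $X$ is a compact metric space and $f_{1,\infty}=(f_n)_{n\in\mathbb{N}}$ is a sequence of continuous maps $f_n:X\to X$. ''Opene'' means nonempty and open. $\Sigma=\{(n_1,\dots,n_p): p\in\mathbb{N},\ n_i\in\mathbb{N}\}$ is the set of finite (nonempty) words over $\mathbb{N}$, and for $\alpha=(n_1,\dots,n_p)\in\Sigma$, $f_\alpha:=f_{n_p}\circ\cdots\circ f_{n_1}$. $N_e(x,U)=\{\alpha\in\Sigma: f_\alpha(x)\in U\}$. The extended orbit of $x$ is $J(x)=\{f_\alpha(x):\alpha\in\Sigma\}$; $x$ is an extended transitive point if $J(x)$ is dense in $X$, and $T_e(f_{1,\infty})$ is the set of such points. A subset $A\subset X$ is strong $+$ invariant if $f_n(A)\subset A$ for all $n\in\mathbb{N}$. The system is extended minimal if there is no proper, nonempty, closed, strong $+$ invariant subset of $X$. *)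

(* Defs.v *)
From mathcomp Require Import all_boot all_order all_algebra.
From mathcomp Require Import all_classical all_reals all_analysis.

Set Implicit Arguments.
Unset Strict Implicit.
Unset Printing Implicit Defensive.

Local Open Scope classical_set_scope.

(* Indices start at 1, as the sequence is f_1, f_2, ... *)
Definition posnat : Type := {n : nat | (0 < n)%N}.

Definition word : Type := {s : seq posnat | s != [::]}.

Definition is_NDDS (R : realType) (X : metricType R) (f : posnat -> X -> X) :
  Prop := compact [set: X] /\ forall n, continuous (f n).

Section Dynamics.
Context {T : Type}.
Implicit Types (f : posnat -> T -> T) (A U : set T) (x : T).

(* The first letter of the word is applied first:
   for (n_1, ..., n_p) this is f n_p \o ... \o f n_1. *)
Definition comp_word f (a : word) : T -> T :=
  foldl (fun g n => f n \o g) id (val a).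

Definition hitting_words f x U : set word := [set a | U (comp_word f a x)].

Definition ext_orbit f x : set T := [set comp_word f a x | a in [set: word]].

Definition strong_plus_invariant f A : Prop := forall n, f n @` A `<=` A.

End Dynamics.

Section TopologicalDynamics.
Context {X : topologicalType}.
Implicit Types (f : posnat -> X -> X).

Definition opene (U : set X) : Prop := U !=set0 /\ open U.

Definition ext_transitive_points f : set X := [set x | dense (ext_orbit f x)].

Definition ext_minimal f : Prop :=
  ~ exists A : set X,
      [/\ A `<` [set: X], A !=set0, closed A & strong_plus_invariant f A].

End TopologicalDynamics.

(* Main.v *)
(* Each closure of an extended orbit is a nonempty closed strong + invariant
   set, so minimality makes every extended orbit dense.  Conversely, if the
   complement of a closed invariant set A is nonempty, then no orbit starting
   in A reaches it.  Compactness turns (vi) into (vii). *)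

Require Import Defs.
From mathcomp Require Import all_boot all_order all_algebra.
From mathcomp Require Import all_classical all_reals all_analysis.

Local Open Scope classical_set_scope.

(* The library's compact_cover is only available for pointed spaces. *)
Lemma compact_countable_cover {X : topologicalType} {I : countType}
    (F : I -> set X) (A : set X) :
  compact A -> (forall i, open (F i)) -> A `<=` \bigcup_i F i ->
  exists2 S : set I, finite_set S & A `<=` \bigcup_(i in S) F i.
Proof.
move=> /compact_near_coveringP cA oF AF.
(* Near-covering along [\oo]: stage [n] allows only the indices whose code [pickle i] is below [n].
   Each point is covered near itself from some stage on, so compactness gives one stage [N] for all
   of [A]. *)
have [|N _ /(_ N (leqnn N)) AN] :=
  cA nat \oo (fun n x => exists2 i, (pickle i < n)%N & F i x) _.
  move=> x /AF [i _ Fix].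
  exists (F i, [set n | (pickle i < n)%N]) => /=.
    by split; [exact: open_nbhs_nbhs|exists (pickle i).+1].
  by move=> [y n] /= [Fiy lt_in]; exists i.
exists [set i | (pickle i < N)%N]; last by move=> x /AN [i]; exists i.
(* Only finitely many indices have a code below [N], since [pickle] is injective. *)
apply: (@finite_preimage _ _ `I_N pickle) => //.
by move=> i j _ _; apply: (pcan_inj pickleK).
Qed.

Section Words.
Context {T : Type}.
Implicit Types (f : posnat -> T -> T) (A : set T) (x : T) (n : posnat).

Definition word1 n : word := exist (fun s => s != [::]) [:: n] isT.

Lemma rcons_neq_nil {S : eqType} (s : seq S) (y : S) : rcons s y != [::].
Proof. by case: s. Qed.

Definition word_rcons (a : word) n : word :=
  exist (fun s => s != [::]) (rcons (val a) n) (rcons_neq_nil _ _).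

Lemma comp_word_rcons f (a : word) n x :
  comp_word f (word_rcons a n) x = f n (comp_word f a x).
Proof. by rewrite /comp_word /= foldl_rcons. Qed.

Lemma comp_word_strong_plus_invariant f A (a : word) x :
  strong_plus_invariant f A -> A x -> A (comp_word f a x).
Proof.
move=> fA Ax; rewrite /comp_word.
(* Induction from the right end of the word, because its last letter is the outermost map. *)
elim/last_ind: (val a) => [//|s n IHs]; rewrite foldl_rcons /=.
by apply: (fA n); exists (foldl (fun g n => f n \o g) id s x).
Qed.

Lemma ext_orbit_neq0 f x : ext_orbit f x !=set0.
Proof.
(* Words are nonempty, so the witness is the image of [x] under the first map rather than [x]
   itself. *)
by exists (comp_word f (word1 (exist _ 1%N isT)) x); eexists.
Qed.

Lemma ext_orbit_strong_plus_invariant f x :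
  strong_plus_invariant f (ext_orbit f x).
Proof.
move=> n _ [_ [a _ <-] <-]; exists (word_rcons a n) => //.
exact: comp_word_rcons.
Qed.

End Words.

Lemma comp_word_continuous {X : topologicalType} (f : posnat -> X -> X)
    (a : word) :
  (forall n, continuous (f n)) -> continuous (comp_word f a).
Proof.
move=> cf; rewrite /comp_word.
elim/last_ind: (val a) => [x|s n IHs x]; first exact: cvg_id.
rewrite foldl_rcons; apply: continuous_comp; [exact: IHs|exact: cf].
Qed.

(** By continuity, a neighbourhood of [f n x] pulls back to a neighbourhood of [x], which meets [A];
    the image of a common point lies in [A] again. *)
Lemma closure_strong_plus_invariant {X : topologicalType}
    (f : posnat -> X -> X) (A : set X) :
  (forall n, continuous (f n)) ->
  strong_plus_invariant f A -> strong_plus_invariant f (closure A).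
Proof.
move=> cf fA n _ [x Ax <-] B /cf /Ax [y [Ay By]].
by exists (f n y); split=> //; apply: (fA n); exists y.
Qed.

Theorem theorem3p7 (R : realType) (X : metricType R) (f : posnat -> X -> X)
    (hf : is_NDDS f) :
  [<-> (* (i) *)
       ext_minimal f;
       (* (ii) *)
       forall U : set X, opene U -> forall x : X,
         exists a : word, U (comp_word f a x);
       (* (iii) *)
       forall U : set X, opene U -> forall x : X, hitting_words f x U !=set0;
       (* (iv) *)
       forall x : X, dense (ext_orbit f x);
       (* (v) *)
       ext_transitive_points f = [set: X];
       (* (vi) *)
       forall U : set X, opene U ->
         \bigcup_(a in [set: word]) (comp_word f a @^-1` U) = [set: X];
       (* (vii) *)
       forall U : set X, opene U -> exists2 S : set word, finite_set S &
         \bigcup_(a in S) (comp_word f a @^-1` U) = [set: X];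
       (* (viii) *)
       forall A : set X, A !=set0 -> closed A -> strong_plus_invariant f A ->
         A = [set: X]].
Proof.
have [cptX cf] := hf.
(* The implications form a cycle in the listed order, closing from (viii) back to (i). *)
tfae.
- move=> minf U [U0 oU] x.
  have clT : closure (ext_orbit f x) = [set: X].
    apply: contrapT => /eqP nT; apply: minf; exists (closure (ext_orbit f x)).
    split.
    + by rewrite properEneq; split.
    + have [y Jy] := ext_orbit_neq0 f x.
      by exists y; apply: subset_closure.
    + exact: closed_closure.
    + apply: closure_strong_plus_invariant => //.
      exact: ext_orbit_strong_plus_invariant.
  have [y Uy] := U0.
  have : closure (ext_orbit f x) y by rewrite clT.
  move=> /(_ U (open_nbhs_nbhs (conj oU Uy))) [_ [[a _ <-] Ua]].
  by exists a.
- by move=> hit U oU x; apply: hit.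
- move=> hit x U U0 oU; have [a Ua] := hit U (conj U0 oU) x.
  by exists (comp_word f a x); split=> //; exists a.
- by move=> dJ; apply/seteqP; split=> // x _; apply: dJ.
- move=> TeT U [U0 oU]; apply/seteqP; split=> // x _.
  have : ext_transitive_points f x by rewrite TeT.
  by move=> /(_ U U0 oU) [_ [/[swap] -[a _ <-] Ua]]; exists a.
- move=> covU U oU.
  (* There are countably many words, and the preimages of [U] under them form an open cover of
     [X]. *)
  have [||S finS XS] := compact_countable_cover
    (fun a => comp_word f a @^-1` U) _ cptX.
  + move=> a; apply: open_comp; last exact: oU.2.
    by move=> x _; apply: comp_word_continuous.
  + by rewrite covU.
  + by exists S => //; apply/seteqP; split.
- move=> finU A [x Ax] clA fA; apply: contrapT => /eqP AT.
  (* The target set for (vii) is the complement of [A]: some word must send [x] out of [A], against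
     invariance. *)
  have oCA : opene (~` A).
    split; last exact: closed_openC.
    by apply/set0P; apply: contra AT => /eqP CA0; rewrite -(setCK A) CA0 setC0.
  have [S _ covS] := finU _ oCA.
  have : [set: X] x by [].
  rewrite -covS => -[a _]; apply.
  exact: comp_word_strong_plus_invariant.
- move=> maxA [A [AT A0 clA fA]].
  by move: AT; rewrite (maxA A A0 clA fA) => /properxx.
Qed.
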